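(* Let $t_0>0$, let $\alpha,\beta,\gamma$ be quotients of odd positive integers, let $r_1,r_2\in C([t_0,\infty),(0,\infty))$ satisfy $\int_{t_0}^{\infty}r_1^{-1/\alpha}(s)\,ds<\infty$ and $\int_{t_0}^{\infty}r_2^{-1/\beta}(s)\,ds<\infty$, let $q\in C([t_0,\infty),[0,\infty))$ not vanish eventually, and let $\sigma\in C^1([t_0,\infty),(0,\infty))$ satisfy $\sigma(t)\ge t$ and $\sigma'(t)\ge 0$ for all $t\ge t_0$. Consider the equation $$\left(r_2(t)\left(\left(r_1(t)(y'(t))^{\alpha}\right)'\right)^{\beta}\right)'+q(t)\,y^{\gamma}(\sigma(t))=0,\quad t\ge t_0.\qquad (E)$$ Let $\pi_1(t)=\int_t^{\infty}r_1^{-1/\alpha}(s)\,ds$. If $$\limsup_{t\to\infty}\ \pi_1^{\frac{\gamma}{\beta}}(\sigma(t))\int_{t_1}^{t}r_2^{-\frac1\beta}(u)\left(\int_{t_1}^{u}q(s)\,ds\right)^{\frac1\beta}du>1$$ for any $t_1\ge t_0$, and $\gamma=\alpha\beta$, then $(E)$ has property A.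
   Context: Powers whose exponents are quotients of odd positive integers are taken as real-valued odd functions, also for negative arguments. ''$q$ does not vanish eventually'' means that $q$ is not identically zero on any half-line $[T,\infty)$. A solution of $(E)$ is a nontrivial real-valued function $y\in C([T_y,\infty),\mathbb{R})$, $T_y\ge t_0$, such that $y$, $r_1(y')^{\alpha}$ and $r_2((r_1(y')^{\alpha})')^{\beta}$ are continuous and differentiable on $[T_y,\infty)$ and $y$ satisfies $(E)$ on $[T_y,\infty)$. Only solutions with $\sup\{|y(t)|:T\le t<\infty\}>0$ for every $T\ge T_y$ are considered, and it is assumed that $(E)$ possesses such solutions. A solution is oscillatory if it has arbitrarily large zeros in $[T_y,\infty)$, and nonoscillatory otherwise. Equation $(E)$ has property A if every solution $y$ is either oscillatory or satisfies $\lim_{t\to\infty}y(t)=0$. ''For any $t_1\ge t_0$'' means for every $t_1\ge t_0$. *)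

(* Defs.v *)
From Stdlib Require Import Reals.
From Coquelicot Require Import Coquelicot.
Open Scope R_scope.

Definition half_line (T : R) : R -> Prop := fun t => T <= t.

Definition odd_quotient (a : R) : Prop :=
  exists m n : nat, Nat.Odd m /\ Nat.Odd n /\ a = INR m / INR n.

(* The real odd power x^a for a a quotient of odd positive integers; the factor
   [sign x] also gives 0^a = 0, whereas [Rpower 0 a] = 1 in the library. *)
Definition opow (x a : R) : R := sign x * Rpower (Rabs x) a.

(* limsup of f at +oo, as inf over T of sup over t >= T. *)
Definition LimSup_pinfty (f : R -> R) : Rbar :=
  Rbar_glb (fun L : Rbar =>
    exists T : R, L = Lub_Rbar (fun v : R => exists t : R, T <= t /\ v = f t)).

(* Derivatives are relative to [T, +oo), so one-sided at T: [D_in f df D t]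
   says that df t is the derivative at t of the restriction of f to D. *)
Definition is_solution (alpha beta gamma : R) (r1 r2 q sigma : R -> R)
    (T : R) (y : R -> R) : Prop :=
  (exists t : R, T <= t /\ y t <> 0) /\
  exists dy dL1 dL2 : R -> R,
    let L1 := fun t => r1 t * opow (dy t) alpha in
    let L2 := fun t => r2 t * opow (dL1 t) beta in
    continuous_on (half_line T) y /\
    continuous_on (half_line T) L1 /\
    continuous_on (half_line T) L2 /\
    forall t : R, T <= t ->
      D_in y dy (half_line T) t /\
      D_in L1 dL1 (half_line T) t /\
      D_in L2 dL2 (half_line T) t /\
      dL2 t + q t * opow (y (sigma t)) gamma = 0.

Definition proper_solution (t0 alpha beta gamma : R) (r1 r2 q sigma : R -> R)
    (Ty : R) (y : R -> R) : Prop :=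
  t0 <= Ty /\
  is_solution alpha beta gamma r1 r2 q sigma Ty y /\
  forall T : R, Ty <= T ->
    Rbar_lt 0 (Lub_Rbar (fun v : R => exists t : R, T <= t /\ v = Rabs (y t))).

Definition oscillatory (Ty : R) (y : R -> R) : Prop :=
  forall T : R, exists t : R, T <= t /\ Ty <= t /\ y t = 0.

Definition property_A (t0 alpha beta gamma : R) (r1 r2 q sigma : R -> R) : Prop :=
  forall (Ty : R) (y : R -> R),
    proper_solution t0 alpha beta gamma r1 r2 q sigma Ty y ->
    oscillatory Ty y \/ is_lim y p_infty 0.

Definition tail_integral (a : R) (r : R -> R) (t : R) : R :=
  RInt_gen (fun s => Rpower (r s) (- (1 / a))) (at_point t) (Rbar_locally p_infty).

(* Main.v *)
Require Import Defs.
From Stdlib Require Import Reals Lra.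
From Coquelicot Require Import Coquelicot.
Open Scope R_scope.

(** Write [L1 = r1 (y')^alpha] and [L2 = r2 (L1')^beta].  The equation is then
    the first-order system
      y' = w1 L1^(1/alpha),   L1' = w2 L2^(1/beta),   L2' = - q (y o sigma)^gamma
    with the integrable weights [w1 = r1^(-1/alpha)] and [w2 = r2^(-1/beta)].
    Everything in it is odd in [(y, L1, L2)], so a nonoscillatory solution may
    be taken positive on some [[T, oo)], and then [L2] is nonincreasing there.
    Let [I a t] be the iterated integral of the limsup condition, from [a] to
    [t], and [pi1] the tail integral of [w1].

    Since [pi1] tends to 0, the limsup condition makes [I a] unbounded, and
    since [w2] is integrable, [I a] can only be unbounded if [int q] is.

    Suppose [L2 a <= 0] for some [a].  Integrating the system twice, a bound
    [c <= y o sigma] on [[a, t]] gives [L1 t <= L1 a - c^alpha I a t], because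
    [gamma / beta = alpha] ([L1_descent]).
    - If [L1] stays positive, [y] increases, [c = y a] is such a bound for every
      [t], and [L1] would tend to minus infinity.
    - Otherwise [L1 b <= 0] for some [b >= a] and [y] decreases from [b] on, so
      that [c = y (sigma t)] is a bound on [[b, t]] and
      [- L1 t >= y (sigma t)^alpha I b t].  A positive function whose slope
      stays below [- w1 m^(1/alpha)] must start above [m^(1/alpha) pi1]
      ([y_ge_tail1_mult_L1]); at [sigma t] this gives
      [y (sigma t) >= pi1 (sigma t) (I b t)^(1/alpha) y (sigma t)].  Dividing by
      [y (sigma t)], [pi1 (sigma t)^alpha * I b t <= 1] for all [t >= b],
      against the limsup condition.

    Hence [L2 > 0] ([L2_gt_0]).  Then [y] has no positive lower bound near
    infinity, as otherwise [L2' <= - c^gamma q] with [int q] infinite would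
    force [L2] below 0.  In particular [L1], which is nondecreasing, is never
    positive, so [y] is nonincreasing and tends to 0. *)

(** * Real odd powers *)

Lemma opow_pos_eq (x a : R) : 0 < x -> opow x a = Rpower x a.
Proof.
  intros hx. unfold opow. rewrite sign_eq_1, Rabs_pos_eq by lra. ring.
Qed.

Lemma opow_0 (a : R) : opow 0 a = 0.
Proof. unfold opow. rewrite sign_0. ring. Qed.

Lemma opow_1_l (a : R) : opow 1 a = 1.
Proof.
  rewrite opow_pos_eq by lra.
  unfold Rpower. rewrite ln_1, Rmult_0_r. apply exp_0.
Qed.

Lemma opow_opp (x a : R) : opow (- x) a = - opow x a.
Proof. unfold opow. rewrite sign_opp, Rabs_Ropp. ring. Qed.

Lemma opow_gt_0 (x a : R) : 0 < x -> 0 < opow x a.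
Proof. intros hx. rewrite opow_pos_eq by assumption. apply exp_pos. Qed.

Lemma opow_ge_0 (x a : R) : 0 <= x -> 0 <= opow x a.
Proof.
  intros [hx | <-].
  - now apply Rlt_le, opow_gt_0.
  - rewrite opow_0. lra.
Qed.

Lemma opow_mult (x y a : R) : opow (x * y) a = opow x a * opow y a.
Proof.
  destruct (Req_dec x 0) as [-> | hx]; [rewrite Rmult_0_l, opow_0; ring |].
  destruct (Req_dec y 0) as [-> | hy]; [rewrite Rmult_0_r, opow_0; ring |].
  unfold opow. rewrite sign_mult, Rabs_mult.
  rewrite <- Rpower_mult_distr by now apply Rabs_pos_lt.
  ring.
Qed.

Lemma opow_opow (x a b : R) : opow (opow x a) b = opow x (a * b).
Proof.
  assert (hpos : forall z, 0 < z -> opow (opow z a) b = opow z (a * b)).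
  { intros z hz. rewrite (opow_pos_eq (opow z a)) by now apply opow_gt_0.
    rewrite !opow_pos_eq by assumption. apply Rpower_mult. }
  destruct (Rtotal_order x 0) as [hx | [-> | hx]].
  - rewrite <- (Ropp_involutive x), !(opow_opp (- x)), opow_opp, hpos; lra.
  - now rewrite !opow_0.
  - now apply hpos.
Qed.

Lemma opow_1_r (x : R) : opow x 1 = x.
Proof.
  assert (hpos : forall z, 0 < z -> opow z 1 = z).
  { intros z hz. rewrite opow_pos_eq by assumption. now apply Rpower_1. }
  destruct (Rtotal_order x 0) as [hx | [-> | hx]].
  - rewrite <- (Ropp_involutive x), opow_opp, hpos; lra.
  - apply opow_0.
  - now apply hpos.
Qed.

Lemma opow_inv_l (x a : R) : 0 < a -> opow (opow x a) (1 / a) = x.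
Proof.
  intros ha. rewrite opow_opow. replace (a * (1 / a)) with 1 by (field; lra).
  apply opow_1_r.
Qed.

Lemma opow_inv_r (x a : R) : 0 < a -> opow (opow x (1 / a)) a = x.
Proof.
  intros ha. rewrite opow_opow. replace (1 / a * a) with 1 by (field; lra).
  apply opow_1_r.
Qed.

Lemma opow_lt (x y a : R) : 0 < a -> x < y -> opow x a < opow y a.
Proof.
  intros ha hxy.
  assert (hpos : forall u v, 0 <= u -> u < v -> opow u a < opow v a).
  { intros u v [hu | <-] huv.
    - rewrite !opow_pos_eq by lra. apply Rlt_Rpower_l; lra.
    - rewrite opow_0. now apply opow_gt_0. }
  destruct (Rle_lt_dec 0 x) as [hx | hx]; [now apply hpos |].
  destruct (Rlt_le_dec 0 y) as [hy | hy].
  - apply Rlt_trans with 0; [| now apply opow_gt_0].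
    assert (h := opow_gt_0 (- x) a). rewrite opow_opp in h. lra.
  - apply Ropp_lt_cancel. rewrite <- !opow_opp. apply hpos; lra.
Qed.

Lemma opow_le (x y a : R) : 0 < a -> x <= y -> opow x a <= opow y a.
Proof.
  intros ha [hxy | <-]; [| lra]. now apply Rlt_le, opow_lt.
Qed.

(** [opow _ a] is a strictly increasing bijection with inverse
    [opow _ (1 / a)], so the preimage of an open interval is again one.  This
    argument makes no exception for the origin, where the formula through
    [Rpower] says nothing. *)
Lemma continuous_opow (a x : R) : 0 < a -> continuous (fun u => opow u a) x.
Proof.
  intros ha.
  assert (hia : 0 < 1 / a) by (apply Rdiv_lt_0_compat; lra).
  intros P [eps hP].
  set (lo := opow (opow x a - eps) (1 / a)).
  set (hi := opow (opow x a + eps) (1 / a)).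
  assert (heps := cond_pos eps).
  assert (hlo : lo < x).
  { rewrite <- (opow_inv_l x a ha). apply opow_lt; lra. }
  assert (hhi : x < hi).
  { rewrite <- (opow_inv_l x a ha). apply opow_lt; lra. }
  assert (hd : 0 < Rmin (x - lo) (hi - x)) by (apply Rmin_pos; lra).
  exists (mkposreal _ hd). intros z hz. apply hP.
  change (Rabs (opow z a - opow x a) < eps).
  change (Rabs (z - x) < Rmin (x - lo) (hi - x)) in hz.
  assert (h1 := Rmin_l (x - lo) (hi - x)).
  assert (h2 := Rmin_r (x - lo) (hi - x)).
  apply Rabs_def2 in hz.
  assert (h3 : opow lo a < opow z a) by (apply opow_lt; lra).
  assert (h4 : opow z a < opow hi a) by (apply opow_lt; lra).
  unfold lo in h3; unfold hi in h4. rewrite opow_inv_r in h3, h4 by assumption.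
  apply Rabs_def1; lra.
Qed.

(** Turns the quasi-derivative [r * d ^ a = L] into an explicit formula for
    the derivative [d]. *)
Lemma opow_solve (r d a : R) : 0 < a -> 0 < r ->
  d = Rpower r (- (1 / a)) * opow (r * opow d a) (1 / a).
Proof.
  intros ha hr.
  rewrite opow_mult, opow_inv_l, opow_pos_eq by assumption.
  rewrite <- Rmult_assoc, <- Rpower_plus, Rplus_opp_l, Rpower_O by assumption.
  ring.
Qed.

Lemma odd_quotient_gt_0 (a : R) : odd_quotient a -> 0 < a.
Proof.
  assert (hodd : forall k, Nat.Odd k -> 0 < INR k).
  { intros k [j ->]. apply lt_0_INR. rewrite Nat.add_1_r. apply Nat.lt_0_succ. }
  intros (m & n & hm & hn & ->). apply Rdiv_lt_0_compat; auto.
Qed.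

(** * Calculus on a half-line *)

(** Right of the end point of a half-line, continuity relative to it is
    two-sided, and likewise for derivatives below.  All the analysis takes place
    there. *)
Lemma continuous_half_line (f : R -> R) (t0 t : R) :
  continuous_on (half_line t0) f -> t0 < t -> continuous f t.
Proof.
  intros hf ht P hP.
  assert (h : half_line t0 t) by (unfold half_line; lra).
  specialize (hf t h P hP). unfold filtermap, within in hf.
  assert (hd : 0 < t - t0) by lra.
  apply filter_imp
    with (2 := filter_and _ _ hf (locally_ball t (mkposreal _ hd))).
  intros x [hx hb]. apply hx.
  change (Rabs (x - t) < t - t0) in hb. apply Rabs_def2 in hb.
  unfold half_line. lra.
Qed.

Lemma D_in_half_line (f df : R -> R) (T t : R) :
  D_in f df (half_line T) t -> T < t -> is_derive f t (df t).
Proof.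
  intros hf ht. apply is_derive_Reals. intros eps heps.
  destruct (hf eps heps) as (d & hd & hlim).
  assert (hd' : 0 < Rmin d (t - T)) by (apply Rmin_pos; lra).
  exists (mkposreal _ hd'). intros h hh0 hh. simpl in hh.
  assert (h1 := Rmin_l d (t - T)). assert (h2 := Rmin_r d (t - T)).
  assert (hd2 : Rabs h < d) by lra.
  apply Rabs_def2 in hh.
  specialize (hlim (t + h)).
  unfold D_x, half_line in hlim. simpl in hlim. unfold Rdist in hlim.
  replace (t + h - t) with h in hlim by ring.
  apply hlim. repeat split; lra.
Qed.

Lemma ex_RInt_continuous_gt (t0 a b : R) (g : R -> R) :
  t0 < a -> a <= b -> (forall x, t0 < x -> continuous g x) -> ex_RInt g a b.
Proof.
  intros ha hab hg. apply (@ex_RInt_continuous R_CompleteNormedModule).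
  intros x hx. rewrite Rmin_left in hx by lra. apply hg. lra.
Qed.

Lemma is_derive_primitive (t0 a x : R) (g : R -> R) :
  t0 < a -> t0 < x -> (forall u, t0 < u -> continuous g u) ->
  is_derive (fun u => RInt g a u) x (g x).
Proof.
  intros ha hx hg.
  apply (@is_derive_RInt R_NormedModule g (fun u => RInt g a u) a);
    [| now apply hg].
  assert (hd : 0 < x - t0) by lra.
  exists (mkposreal _ hd). intros u hu.
  change (Rabs (u - x) < x - t0) in hu. apply Rabs_def2 in hu.
  apply (@RInt_correct R_CompleteNormedModule).
  apply (@ex_RInt_continuous R_CompleteNormedModule).
  intros z [hz _]. apply hg.
  apply Rlt_le_trans with (2 := hz). apply Rmin_glb_lt; lra.
Qed.

Lemma continuous_primitive (t0 a x : R) (g : R -> R) :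
  t0 < a -> t0 < x -> (forall u, t0 < u -> continuous g u) ->
  continuous (fun u => RInt g a u) x.
Proof.
  intros ha hx hg. apply (@ex_derive_continuous R_AbsRing R_NormedModule).
  exists (g x). now apply is_derive_primitive with t0.
Qed.

(** The mean value theorem applied to [f - k * int g].  It serves in place of
    the fundamental theorem of calculus because [df] is not assumed
    continuous. *)
Lemma increment_le_RInt (t0 a b k : R) (f df g : R -> R) :
  t0 < a -> a <= b -> (forall x, t0 < x -> continuous g x) ->
  (forall x, a <= x <= b -> is_derive f x (df x)) ->
  (forall x, a <= x <= b -> df x <= k * g x) ->
  f b - f a <= k * RInt g a b.
Proof.
  intros ha hab hg hf hle.
  assert (hd : forall x, a <= x <= b ->
    is_derive (fun u => f u - k * RInt g a u) x (df x - k * g x)).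
  { intros x hx.
    apply (@is_derive_minus R_AbsRing R_NormedModule); [now apply hf |].
    apply (is_derive_scal (fun u => RInt g a u)).
    apply is_derive_primitive with t0; [lra | lra | exact hg]. }
  destruct (MVT_gen (fun u => f u - k * RInt g a u) a b
              (fun x => df x - k * g x)) as (c & hc & heq).
  - rewrite Rmin_left, Rmax_right by lra. intros x hx. apply hd. lra.
  - rewrite Rmin_left, Rmax_right by lra. intros x hx.
    apply derivable_continuous_pt. exists (df x - k * g x).
    apply is_derive_Reals. now apply hd.
  - rewrite Rmin_left, Rmax_right in hc by lra.
    rewrite RInt_point in heq. change (@zero _) with 0 in heq.
    assert (h := hle c hc). nra.
Qed.

Lemma decreasing_of_derive_le_0 (a b : R) (f df : R -> R) :
  a <= b ->
  (forall x, a <= x <= b -> is_derive f x (df x)) ->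
  (forall x, a <= x <= b -> df x <= 0) ->
  f b <= f a.
Proof.
  intros hab hf hle.
  assert (h : f b - f a <= 0 * RInt (fun _ => 0) a b).
  { apply increment_le_RInt with (a - 1) df; [lra | lra | | exact hf |].
    - intros x _. apply continuous_const.
    - intros x hx. specialize (hle x hx). lra. }
  lra.
Qed.

Lemma increasing_of_derive_ge_0 (a b : R) (f df : R -> R) :
  a <= b ->
  (forall x, a <= x <= b -> is_derive f x (df x)) ->
  (forall x, a <= x <= b -> 0 <= df x) ->
  f a <= f b.
Proof.
  intros hab hf hge. apply Ropp_le_cancel.
  apply decreasing_of_derive_le_0
    with (f := fun x => - f x) (df := fun x => - df x); [exact hab | |].
  - intros x hx.
    apply (@is_derive_opp R_AbsRing R_NormedModule). now apply hf.
  - intros x hx. specialize (hge x hx). lra.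
Qed.

Lemma constant_sign_of_nonzero (T : R) (y : R -> R) :
  (forall t, T <= t -> continuous y t) ->
  (forall t, T <= t -> y t <> 0) ->
  (forall t, T <= t -> 0 < y t) \/ (forall t, T <= t -> y t < 0).
Proof.
  intros hc hnz.
  assert (hcross : forall (f : R -> R), (forall t, T <= t -> continuous f t) ->
    (forall t, T <= t -> f t <> 0) -> f T < 0 ->
    forall t, T <= t -> f t < 0).
  { intros f hfc hfnz hT t ht.
    destruct (Rlt_le_dec (f t) 0) as [h | h]; [exact h | exfalso].
    assert (hneq := hfnz t ht).
    assert (hTt : T < t).
    { destruct ht as [ht | <-]; [exact ht | lra]. }
    destruct (Ranalysis5.IVT_interv f T t) as (z & hz & hfz); [| lra | lra | lra |].
    - intros x hx. apply continuity_pt_filterlim. apply hfc. lra.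
    - apply (hfnz z); [lra | exact hfz]. }
  assert (hT := hnz T (Rle_refl T)).
  destruct (Rlt_le_dec (y T) 0) as [hneg | hpos].
  - right. now apply hcross.
  - left. intros t ht.
    assert (h : - y t < 0); [| lra].
    apply (hcross (fun u => - y u)); [| | lra | exact ht].
    + intros u hu. apply (@continuous_opp R_UniformSpace R_AbsRing R_NormedModule).
      now apply hc.
    + intros u hu. specialize (hnz u hu). lra.
Qed.

(** * Convergent improper integrals and limits superior *)

(** Replaces the filter-based improper integral by limits of proper
    integrals from the fixed base point [t0]. *)
Lemma ex_RInt_gen_tail (f : R -> R) (t0 : R) :
  ex_RInt_gen f (at_point t0) (Rbar_locally p_infty) ->
  exists l : R,
    (forall b, t0 <= b -> ex_RInt f t0 b) /\
    is_lim (fun b => RInt f t0 b) p_infty l /\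
    forall t, t0 <= t ->
      RInt_gen f (at_point t) (Rbar_locally p_infty) = l - RInt f t0 t.
Proof.
  intros [l hl]. exists l.
  assert (hev : forall P : R -> Prop, locally l P ->
    exists N, forall b, N < b -> exists v, is_RInt f t0 b v /\ P v).
  { intros P hP. destruct (hl P hP) as [A B hA [N hN] h].
    exists N. intros b hb. destruct (h t0 b hA (hN b hb)) as (v & hv & hPv).
    now exists v. }
  assert (hex : forall b, t0 <= b -> ex_RInt f t0 b).
  { intros b hb. destruct (hev (fun _ => True)) as [N hN].
    { now apply filter_forall. }
    assert (h1 := Rmax_l N b). assert (h2 := Rmax_r N b).
    destruct (hN (Rmax N b + 1)) as (v & hv & _); [lra |].
    apply (@ex_RInt_Chasles_1 R_CompleteNormedModule)
      with (Rmax N b + 1); [lra | now exists v]. }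
  split; [exact hex |]. split.
  - intros P hP. destruct (hev P hP) as [N hN].
    exists N. intros b hb. destruct (hN b hb) as (v & hv & hPv).
    now rewrite (is_RInt_unique f t0 b v hv).
  - intros t ht.
    apply (@is_RInt_gen_unique R_CompleteNormedModule); [exact _ | exact _ |].
    replace (l - RInt f t0 t) with (plus (opp (RInt f t0 t)) l)
      by (change (- RInt f t0 t + l = l - RInt f t0 t); ring).
    apply (is_RInt_gen_Chasles f t0); [| exact hl].
    apply is_RInt_gen_at_point.
    apply (@is_RInt_swap R_NormedModule).
    apply (@RInt_correct R_CompleteNormedModule). now apply hex.
Qed.

(** If [f <= c] on [[T, oo)], then [c] bounds the supremum of [f] there, and the
    limit superior is the infimum of such suprema. *)
Lemma LimSup_gt_frequently (f : R -> R) (c : R) :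
  Rbar_lt c (LimSup_pinfty f) -> forall T, exists t, T <= t /\ c < f t.
Proof.
  intros h T. apply Classical_Prop.NNPP. intros hno.
  revert h. apply Rbar_le_not_lt.
  unfold LimSup_pinfty, Rbar_glb.
  destruct (Rbar_ex_glb _) as [g [hlow hgreatest]]. simpl.
  apply Rbar_le_trans with (1 := hlow _ (ex_intro _ T eq_refl)).
  apply Lub_Rbar_correct. intros v (t & ht & ->). simpl.
  apply Rnot_lt_le. intros hlt. apply hno. now exists t.
Qed.

(** * Eventually positive solutions *)

Section Positive_solution.

(** The equation as a first-order system, with [w1], [w2] in the role of
    [r1 ^ (- 1/alpha)], [r2 ^ (- 1/beta)].  The limsup condition enters as
    [hfreq], with [gamma / beta] already replaced by [alpha]. *)
Context (t0 T alpha beta gamma : R) (w1 w2 q sigma y L1 L2 : R -> R).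

Definition iterated_kernel (a u : R) : R :=
  w2 u * opow (RInt q a u) (1 / beta).

Definition iterated_integral (a t : R) : R := RInt (iterated_kernel a) a t.

(** This is [pi1]; the limsup condition evaluates it at [sigma t]. *)
Definition tail1 (t : R) : R :=
  RInt_gen w1 (at_point t) (Rbar_locally p_infty).

Context
  (halpha : 0 < alpha) (hbeta : 0 < beta) (hgamma : gamma = alpha * beta)
  (hT : t0 < T)
  (hw1c : forall t, t0 < t -> continuous w1 t)
  (hw1p : forall t, 0 < w1 t)
  (hw1i : ex_RInt_gen w1 (at_point t0) (Rbar_locally p_infty))
  (hw2c : forall t, t0 < t -> continuous w2 t)
  (hw2p : forall t, 0 < w2 t)
  (hw2i : ex_RInt_gen w2 (at_point t0) (Rbar_locally p_infty))
  (hqc : forall t, t0 < t -> continuous q t)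
  (hqp : forall t, t0 < t -> 0 <= q t)
  (hsadv : forall t, T <= t -> t <= sigma t)
  (hsmon : forall s t, T <= s -> s <= t -> sigma s <= sigma t)
  (hy : forall t, T <= t -> is_derive y t (w1 t * opow (L1 t) (1 / alpha)))
  (hL1 : forall t, T <= t -> is_derive L1 t (w2 t * opow (L2 t) (1 / beta)))
  (hL2 : forall t, T <= t ->
     is_derive L2 t (- (q t * opow (y (sigma t)) gamma)))
  (hpos : forall t, T <= t -> 0 < y t)
  (hfreq : forall a, T <= a -> forall M, exists t, M <= t /\
     1 < opow (tail1 (sigma t)) alpha * iterated_integral a t).

Let hia : 0 < 1 / alpha.
Proof. apply Rdiv_lt_0_compat; lra. Qed.

Let hib : 0 < 1 / beta.
Proof. apply Rdiv_lt_0_compat; lra. Qed.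

Lemma gamma_gt_0 : 0 < gamma.
Proof. rewrite hgamma. now apply Rmult_lt_0_compat. Qed.

Lemma iterated_kernel_continuous (a u : R) :
  t0 < a -> t0 < u -> continuous (iterated_kernel a) u.
Proof.
  intros ha hu.
  apply (@continuous_mult R_UniformSpace R_AbsRing); [now apply hw2c |].
  apply (continuous_comp (fun v => RInt q a v) (fun x => opow x (1 / beta))).
  - now apply continuous_primitive with t0.
  - now apply continuous_opow.
Qed.

Lemma RInt_q_ge_0 (a t : R) : t0 < a -> a <= t -> 0 <= RInt q a t.
Proof.
  intros ha hat. apply RInt_ge_0; [exact hat | |].
  - now apply ex_RInt_continuous_gt with t0.
  - intros x hx. apply hqp. lra.
Qed.

Lemma iterated_integral_ge_0 (a t : R) :
  t0 < a -> a <= t -> 0 <= iterated_integral a t.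
Proof.
  intros ha hat. unfold iterated_integral. apply RInt_ge_0; [exact hat | |].
  - apply ex_RInt_continuous_gt with t0; [exact ha | exact hat |].
    intros x hx. now apply iterated_kernel_continuous.
  - intros x hx. apply Rmult_le_pos; [now apply Rlt_le |].
    apply opow_ge_0, RInt_q_ge_0; lra.
Qed.

Lemma y_at_sigma_gt_0 (t : R) : T <= t -> 0 < y (sigma t).
Proof. intros ht. apply hpos. specialize (hsadv t ht). lra. Qed.

Lemma L2_decreasing (a b : R) : T <= a -> a <= b -> L2 b <= L2 a.
Proof.
  intros ha hab.
  apply decreasing_of_derive_le_0
    with (df := fun t => - (q t * opow (y (sigma t)) gamma)); [exact hab | |].
  - intros x hx. apply hL2. lra.
  - intros x hx.
    assert (h1 : 0 <= q x) by (apply hqp; lra).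
    assert (h2 : 0 < opow (y (sigma x)) gamma).
    { apply opow_gt_0, y_at_sigma_gt_0. lra. }
    nra.
Qed.

Lemma L1_decreasing (a b : R) :
  T <= a -> a <= b -> L2 a <= 0 -> L1 b <= L1 a.
Proof.
  intros ha hab hneg.
  apply decreasing_of_derive_le_0
    with (df := fun t => w2 t * opow (L2 t) (1 / beta)); [exact hab | |].
  - intros x hx. apply hL1. lra.
  - intros x hx. assert (hw := hw2p x).
    assert (h : L2 x <= L2 a) by (apply L2_decreasing; lra).
    assert (h1 : opow (L2 x) (1 / beta) <= opow 0 (1 / beta))
      by (apply opow_le; lra).
    rewrite opow_0 in h1. nra.
Qed.

Lemma L1_increasing (a b : R) :
  T <= a -> a <= b -> (forall t, a <= t -> 0 <= L2 t) -> L1 a <= L1 b.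
Proof.
  intros ha hab hge.
  apply increasing_of_derive_ge_0
    with (df := fun t => w2 t * opow (L2 t) (1 / beta)); [exact hab | |].
  - intros x hx. apply hL1. lra.
  - intros x hx. apply Rmult_le_pos; [now apply Rlt_le |].
    apply opow_ge_0, hge. lra.
Qed.

Lemma y_increasing (a b : R) :
  T <= a -> a <= b -> (forall t, a <= t -> 0 <= L1 t) -> y a <= y b.
Proof.
  intros ha hab hge.
  apply increasing_of_derive_ge_0
    with (df := fun t => w1 t * opow (L1 t) (1 / alpha)); [exact hab | |].
  - intros x hx. apply hy. lra.
  - intros x hx. apply Rmult_le_pos; [now apply Rlt_le |].
    apply opow_ge_0, hge. lra.
Qed.

Lemma y_decreasing (a b : R) :
  T <= a -> a <= b -> (forall t, a <= t -> L1 t <= 0) -> y b <= y a.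
Proof.
  intros ha hab hle.
  apply decreasing_of_derive_le_0
    with (df := fun t => w1 t * opow (L1 t) (1 / alpha)); [exact hab | |].
  - intros x hx. apply hy. lra.
  - intros x hx. assert (hw := hw1p x).
    assert (h1 : opow (L1 x) (1 / alpha) <= opow 0 (1 / alpha)).
    { apply opow_le; [exact hia |]. apply hle. lra. }
    rewrite opow_0 in h1. nra.
Qed.

(** With [c <= y o sigma], the last equation of the system reads
    [L2' <= - c^gamma q]. *)
Lemma L2_descent (a b c : R) :
  T <= a -> a <= b -> 0 < c -> (forall s, a <= s <= b -> c <= y (sigma s)) ->
  L2 b - L2 a <= - opow c gamma * RInt q a b.
Proof.
  intros ha hab hc hlow.
  apply increment_le_RInt
    with (t0 := t0) (df := fun t => - (q t * opow (y (sigma t)) gamma));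
    [lra | exact hab | exact hqc | |].
  - intros x hx. apply hL2. lra.
  - intros x hx.
    assert (h1 : 0 <= q x) by (apply hqp; lra).
    assert (h2 : opow c gamma <= opow (y (sigma x)) gamma).
    { apply opow_le; [apply gamma_gt_0 | now apply hlow]. }
    nra.
Qed.

(** By [L2_descent], [L2 x <= - c^gamma * int_a^x q].  Taking the power
    [1 / beta] turns [c^gamma] into [c^alpha], and multiplying by [w2] gives
    [L1' <= - c^alpha * iterated_kernel a]. *)
Lemma L1_descent (a b c : R) :
  T <= a -> a <= b -> 0 < c -> (forall s, a <= s <= b -> c <= y (sigma s)) ->
  L2 a <= 0 ->
  L1 b - L1 a <= - opow c alpha * iterated_integral a b.
Proof.
  intros ha hab hc hlow hneg. unfold iterated_integral.
  apply increment_le_RInt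
    with (t0 := t0) (df := fun t => w2 t * opow (L2 t) (1 / beta));
    [lra | exact hab | | |].
  - intros x hx. apply iterated_kernel_continuous; lra.
  - intros x hx. apply hL1. lra.
  - intros x hx. unfold iterated_kernel. assert (hw := hw2p x).
    assert (h1 : L2 x <= - (opow c gamma * RInt q a x)).
    { assert (h : L2 x - L2 a <= - opow c gamma * RInt q a x); [| lra].
      apply L2_descent; try lra. intros s hs. apply hlow. lra. }
    apply (opow_le _ _ _ hib) in h1.
    rewrite opow_opp, opow_mult, opow_opow in h1.
    replace (gamma * (1 / beta)) with alpha in h1
      by (rewrite hgamma; field; lra).
    nra.
Qed.

Lemma tail1_spec (tau : R) : t0 <= tau ->
  is_lim (fun v => RInt w1 tau v) p_infty (tail1 tau).
Proof.
  intros htau.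
  destruct (ex_RInt_gen_tail w1 t0 hw1i) as (l & hex & hlim & heq).
  unfold tail1. rewrite heq by exact htau.
  apply is_lim_ext_loc with (fun v => RInt w1 t0 v - RInt w1 t0 tau).
  - exists tau. intros v hv.
    assert (h : ex_RInt w1 tau v).
    { apply (@ex_RInt_Chasles_2 R_CompleteNormedModule) with t0; [lra |].
      apply hex. lra. }
    assert (h1 := RInt_Chasles w1 t0 tau v (hex tau htau) h).
    change (RInt w1 t0 tau + RInt w1 tau v = RInt w1 t0 v) in h1. lra.
  - apply is_lim_minus'; [exact hlim | apply is_lim_const].
Qed.

Lemma tail1_ge_0 (tau : R) : t0 < tau -> 0 <= tail1 tau.
Proof.
  intros htau.
  apply (is_lim_le_loc (fun _ => 0) (fun v => RInt w1 tau v) p_infty 0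
           (tail1 tau)).
  - exists tau. intros v hv. apply RInt_ge_0; [lra | |].
    + apply ex_RInt_continuous_gt with t0; [lra | lra | exact hw1c].
    + intros x _. now apply Rlt_le.
  - apply is_lim_const.
  - apply tail1_spec. lra.
Qed.

Lemma tail1_eventually_lt (eps : R) :
  0 < eps -> exists N, t0 <= N /\ forall t, N < t -> tail1 t < eps.
Proof.
  intros heps.
  destruct (ex_RInt_gen_tail w1 t0 hw1i) as (l & hex & hlim & heq).
  destruct (hlim (fun v => Rabs (v - l) < eps)) as [N hN].
  { now exists (mkposreal _ heps). }
  exists (Rmax N t0). split; [apply Rmax_r |].
  intros t ht. assert (h1 := Rmax_l N t0). assert (h2 := Rmax_r N t0).
  unfold tail1. rewrite heq by lra.
  assert (h : Rabs (RInt w1 t0 t - l) < eps) by (apply hN; lra).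
  apply Rabs_def2 in h. lra.
Qed.

(** If [iterated_integral a] were bounded, its product with
    [pi1 (sigma t) ^ alpha], which tends to 0, could not exceed 1 for
    arbitrarily large [t]. *)
Lemma iterated_integral_unbounded (a M : R) :
  T <= a -> exists t, a <= t /\ M < iterated_integral a t.
Proof.
  intros ha. apply Classical_Prop.NNPP. intros hno.
  assert (hb : forall t, a <= t -> iterated_integral a t <= M).
  { intros t ht. apply Rnot_lt_le. intros h. apply hno. now exists t. }
  (* [K] is a positive bound, so that [1 / K] is meaningful. *)
  set (K := Rmax M 1). assert (hK := Rmax_l M 1). assert (hK1 := Rmax_r M 1).
  fold K in hK, hK1.
  assert (hinv : 0 < 1 / K) by (apply Rdiv_lt_0_compat; lra).
  destruct (tail1_eventually_lt (opow (1 / K) (1 / alpha))) as (N & hNt0 & hN).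
  { now apply opow_gt_0. }
  destruct (hfreq a ha (Rmax a (N + 1))) as (t & ht & hgt).
  assert (h1 := Rmax_l a (N + 1)). assert (h2 := Rmax_r a (N + 1)).
  assert (hs : t <= sigma t) by (apply hsadv; lra).
  assert (h3 : opow (tail1 (sigma t)) alpha < 1 / K).
  { rewrite <- (opow_inv_r (1 / K) alpha halpha).
    apply opow_lt; [exact halpha |]. apply hN. lra. }
  assert (h4 : 0 <= opow (tail1 (sigma t)) alpha).
  { apply opow_ge_0, tail1_ge_0. lra. }
  assert (h5 : iterated_integral a t <= K).
  { apply Rle_trans with M; [apply hb; lra | exact hK]. }
  assert (h6 : opow (tail1 (sigma t)) alpha * iterated_integral a t
               <= opow (tail1 (sigma t)) alpha * K)
    by now apply Rmult_le_compat_l.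
  assert (h7 : opow (tail1 (sigma t)) alpha * K < 1 / K * K)
    by (apply Rmult_lt_compat_r; lra).
  replace (1 / K * K) with 1 in h7 by (field; lra). lra.
Qed.

Lemma RInt_w2_bounded : exists M, forall a b,
  t0 < a -> a <= b -> RInt w2 a b <= M.
Proof.
  destruct (ex_RInt_gen_tail w2 t0 hw2i) as (l & hex & hlim & _).
  exists l. intros a b ha hab.
  apply (is_lim_le_loc (fun _ => RInt w2 a b) (fun v => RInt w2 t0 v)
           p_infty (RInt w2 a b) l); [| apply is_lim_const | exact hlim].
  exists b. intros v hv.
  assert (hab' := ex_RInt_continuous_gt t0 a b w2 ha hab hw2c).
  assert (hav : ex_RInt w2 a v)
    by (apply ex_RInt_continuous_gt with t0; [exact ha | lra | exact hw2c]).
  assert (hbv : ex_RInt w2 b v)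
    by (apply ex_RInt_continuous_gt with t0; [lra | lra | exact hw2c]).
  assert (h0a : ex_RInt w2 t0 a) by (apply hex; lra).
  assert (e1 := RInt_Chasles w2 t0 a v h0a hav).
  assert (e2 := RInt_Chasles w2 a b v hab' hbv).
  change (RInt w2 t0 a + RInt w2 a v = RInt w2 t0 v) in e1.
  change (RInt w2 a b + RInt w2 b v = RInt w2 a v) in e2.
  assert (p1 : 0 <= RInt w2 t0 a).
  { apply RInt_ge_0; [lra | exact h0a |]. intros x _. now apply Rlt_le. }
  assert (p2 : 0 <= RInt w2 b v).
  { apply RInt_ge_0; [lra | exact hbv |]. intros x _. now apply Rlt_le. }
  lra.
Qed.

(** If [int q <= K], then [iterated_kernel a <= K^(1/beta) w2], whose integrals
    are bounded; but [iterated_integral a] is not. *)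
Lemma RInt_q_unbounded (a K : R) :
  T <= a -> exists t, a <= t /\ K < RInt q a t.
Proof.
  intros ha. apply Classical_Prop.NNPP. intros hno.
  assert (hb : forall t, a <= t -> RInt q a t <= K).
  { intros t ht. apply Rnot_lt_le. intros h. apply hno. now exists t. }
  assert (hK0 : 0 <= K).
  { apply Rle_trans with (RInt q a a); [apply RInt_q_ge_0; lra |].
    apply hb. lra. }
  destruct RInt_w2_bounded as [M hM].
  set (k := opow K (1 / beta)).
  assert (hk : 0 <= k) by now apply opow_ge_0.
  destruct (iterated_integral_unbounded a (k * M) ha) as (t & ht & hgt).
  assert (h : iterated_integral a t - iterated_integral a a <= k * RInt w2 a t).
  { apply increment_le_RInt with (t0 := t0) (df := iterated_kernel a);
      [lra | exact ht | exact hw2c | |].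
    - intros x hx. unfold iterated_integral.
      apply is_derive_primitive with t0; [lra | lra |].
      intros u hu. apply iterated_kernel_continuous; lra.
    - intros x hx. unfold iterated_kernel. rewrite Rmult_comm.
      apply Rmult_le_compat_r; [now apply Rlt_le |].
      apply opow_le; [exact hib |]. apply hb. lra. }
  unfold iterated_integral at 2 in h. rewrite RInt_point in h.
  change (@zero _) with 0 in h.
  assert (h1 : k * RInt w2 a t <= k * M).
  { apply Rmult_le_compat_l; [exact hk |]. apply hM; lra. }
  lra.
Qed.

Lemma L2_negative_of_y_bounded_below (a c : R) :
  T <= a -> 0 < c -> (forall t, a <= t -> c <= y t) ->
  exists t, a <= t /\ L2 t < 0.
Proof.
  intros ha hc hlow.
  assert (hcg := opow_gt_0 c gamma hc).
  destruct (RInt_q_unbounded a (L2 a / opow c gamma) ha) as (t & ht & hgt).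
  exists t. split; [exact ht |].
  assert (h : L2 t - L2 a <= - opow c gamma * RInt q a t).
  { apply L2_descent; try assumption. intros s hs. apply hlow.
    assert (h := hsadv s). lra. }
  assert (h1 : L2 a < opow c gamma * RInt q a t); [| lra].
  rewrite Rmult_comm. now apply Rlt_div_l.
Qed.

(** As [L1] keeps decreasing after [tau], [y' <= - m^(1/alpha) w1] there.
    Integrate from [tau] to [v], use [y v > 0], and let [v] tend to infinity. *)
Lemma y_ge_tail1_mult_L1 (tau m : R) :
  T <= tau -> 0 <= m -> L1 tau <= - m -> L2 tau <= 0 ->
  opow m (1 / alpha) * tail1 tau <= y tau.
Proof.
  intros htau hm hL hneg.
  set (k := opow m (1 / alpha)).
  apply (is_lim_le_loc (fun v => k * RInt w1 tau v) (fun _ => y tau)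
           p_infty (k * tail1 tau) (y tau)).
  - exists tau. intros v hv.
    assert (h : y v - y tau <= - k * RInt w1 tau v).
    { apply increment_le_RInt
        with (t0 := t0) (df := fun t => w1 t * opow (L1 t) (1 / alpha));
        [lra | lra | exact hw1c | |].
      - intros x hx. apply hy. lra.
      - intros x hx. assert (hw := hw1p x).
        assert (h1 : L1 x <= L1 tau) by (apply L1_decreasing; lra).
        assert (h2 : opow (L1 x) (1 / alpha) <= opow (- m) (1 / alpha))
          by (apply opow_le; lra).
        rewrite opow_opp in h2. fold k in h2. nra. }
    assert (h1 : 0 < y v) by (apply hpos; lra). lra.
  - apply (is_lim_scal_l _ k p_infty (tail1 tau)). apply tail1_spec. lra.
  - apply is_lim_const.
Qed.

(** The only place where the constant 1 of the limsup condition matters.  Both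
    cases of the negation, according to the sign of [L1], rest on
    [L1_descent]. *)
Lemma L2_gt_0 (a : R) : T <= a -> 0 < L2 a.
Proof.
  intros ha. destruct (Rlt_le_dec 0 (L2 a)) as [h | hneg]; [exact h | exfalso].
  assert (hL2neg : forall t, a <= t -> L2 t <= 0).
  { intros t ht. assert (h := L2_decreasing a t ha ht). lra. }
  destruct (Classical_Prop.classic (exists b, a <= b /\ L1 b <= 0))
    as [(b & hab & hb) | hno].
  - (* [y] decreases from [b] on: on [[b, t]] the best lower bound of
       [y o sigma] is its value at [t]. *)
    destruct (hfreq b (Rle_trans _ _ _ ha hab) b) as (t & ht & hgt).
    assert (hTb : T <= b) by lra. assert (hTt : T <= t) by lra.
    assert (hs := hsadv t hTt).
    assert (hL1neg : forall u, b <= u -> L1 u <= 0).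
    { intros u hu. assert (h := L1_decreasing b u hTb hu (hL2neg b hab)). lra. }
    set (c := y (sigma t)).
    assert (hc : 0 < c) by now apply y_at_sigma_gt_0.
    set (I := iterated_integral b t) in *.
    assert (hI : 0 <= I) by (apply iterated_integral_ge_0; lra).
    assert (hca := opow_gt_0 c alpha hc).
    assert (hdesc : L1 t - L1 b <= - opow c alpha * I).
    { apply L1_descent; [exact hTb | exact ht | exact hc | | now apply hL2neg].
      intros s hst. assert (h1 := hsadv s).
      apply y_decreasing; [lra | apply hsmon; lra |].
      intros u hu. apply hL1neg. lra. }
    assert (hL1s : L1 (sigma t) <= - (opow c alpha * I)).
    { assert (h := L1_decreasing t (sigma t) hTt hs (hL2neg t ltac:(lra))).
      lra. }
    assert (hlow := y_ge_tail1_mult_L1 (sigma t) (opow c alpha * I)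
                      ltac:(lra) ltac:(nra) hL1s (hL2neg (sigma t) ltac:(lra))).
    fold c in hlow. rewrite opow_mult, opow_inv_l in hlow by exact halpha.
    assert (h1 : opow I (1 / alpha) * tail1 (sigma t) <= 1).
    { apply Rmult_le_reg_l with c; [exact hc |]. lra. }
    apply (opow_le _ _ alpha halpha) in h1.
    rewrite opow_mult, opow_inv_r, opow_1_l in h1 by exact halpha. lra.
  - (* [y] increases from [a] on, so [y a] is a lower bound of [y o sigma]
       uniformly in [t]. *)
    assert (hL1p : forall t, a <= t -> 0 <= L1 t).
    { intros t ht. apply Rnot_lt_le. intros h. apply hno. exists t. lra. }
    assert (hc := hpos a ha). assert (hca := opow_gt_0 (y a) alpha hc).
    destruct (iterated_integral_unbounded a (L1 a / opow (y a) alpha) ha)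
      as (t & ht & hgt).
    assert (hdesc : L1 t - L1 a <= - opow (y a) alpha * iterated_integral a t).
    { apply L1_descent; [exact ha | exact ht | exact hc | | exact hneg].
      intros s hs. assert (h1 := hsadv s). apply y_increasing; [lra | lra |].
      exact hL1p. }
    apply Rlt_div_l in hgt; [| exact hca].
    assert (h1 := hL1p t ht). lra.
Qed.

Lemma positive_solution_tends_to_0 : is_lim y p_infty 0.
Proof.
  assert (hL2ge : forall t, T <= t -> 0 <= L2 t).
  { intros t ht. now apply Rlt_le, L2_gt_0. }
  assert (hnolow : forall a c, T <= a -> 0 < c ->
            ~ (forall t, a <= t -> c <= y t)).
  { intros a c ha hc hlow.
    destruct (L2_negative_of_y_bounded_below a c ha hc hlow) as (t & ht & h).
    assert (h1 := hL2ge t). lra. }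
  assert (hL1le : forall a, T <= a -> L1 a <= 0).
  { intros a ha. apply Rnot_lt_le. intros hL1a.
    apply (hnolow a (y a) ha (hpos a ha)). intros t ht.
    apply y_increasing; [exact ha | exact ht |]. intros u hu.
    assert (h : L1 a <= L1 u); [| lra].
    apply L1_increasing; [exact ha | exact hu |].
    intros v hv. apply hL2ge. lra. }
  apply is_lim_spec. intros eps. assert (heps := cond_pos eps).
  assert (hsmall : exists N, T <= N /\ y N < eps).
  { apply Classical_Prop.NNPP. intros hno.
    apply (hnolow T eps (Rle_refl T) heps). intros t ht.
    apply Rnot_lt_le. intros h. apply hno. now exists t. }
  destruct hsmall as (N & hN & hyN). exists N. intros t ht.
  assert (h1 : y t <= y N).
  { apply y_decreasing; [exact hN | lra |]. intros u hu. apply hL1le. lra. }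
  assert (h2 : 0 < y t) by (apply hpos; lra).
  rewrite Rminus_0_r, Rabs_pos_eq; lra.
Qed.

End Positive_solution.

(** * The equation *)

Lemma continuous_weight (a t0 t : R) (r : R -> R) :
  continuous_on (half_line t0) r -> (forall s, t0 <= s -> 0 < r s) -> t0 < t ->
  continuous (fun s => Rpower (r s) (- (1 / a))) t.
Proof.
  intros hc hp ht.
  apply (continuous_comp r (fun x => Rpower x (- (1 / a)))).
  - now apply continuous_half_line with t0.
  - apply (@ex_derive_continuous R_AbsRing R_NormedModule).
    exists (- (1 / a) * Rpower (r t) (- (1 / a) - 1)).
    apply is_derive_Reals, derivable_pt_lim_power, hp. lra.
Qed.

Theorem theorem2p3 (t0 alpha beta gamma : R) (r1 r2 q sigma dsigma : R -> R)
  (ht0 : 0 < t0)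
  (halpha : odd_quotient alpha)
  (hbeta : odd_quotient beta)
  (hgamma : odd_quotient gamma)
  (hr1c : continuous_on (half_line t0) r1)
  (hr1p : forall t : R, t0 <= t -> 0 < r1 t)
  (hr2c : continuous_on (half_line t0) r2)
  (hr2p : forall t : R, t0 <= t -> 0 < r2 t)
  (hr1i : ex_RInt_gen (fun s => Rpower (r1 s) (- (1 / alpha)))
            (at_point t0) (Rbar_locally p_infty))
  (hr2i : ex_RInt_gen (fun s => Rpower (r2 s) (- (1 / beta)))
            (at_point t0) (Rbar_locally p_infty))
  (hqc : continuous_on (half_line t0) q)
  (hqp : forall t : R, t0 <= t -> 0 <= q t)
  (hqne : forall T : R, t0 <= T -> exists t : R, T <= t /\ q t <> 0)
  (hsp : forall t : R, t0 <= t -> 0 < sigma t)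
  (hsd : forall t : R, t0 <= t -> D_in sigma dsigma (half_line t0) t)
  (hsc : continuous_on (half_line t0) dsigma)
  (hsadv : forall t : R, t0 <= t -> t <= sigma t)
  (hsmon : forall t : R, t0 <= t -> 0 <= dsigma t)
  (hex : exists (Ty : R) (y : R -> R),
           proper_solution t0 alpha beta gamma r1 r2 q sigma Ty y)
  (hlimsup : forall t1 : R, t0 <= t1 ->
     Rbar_lt 1 (LimSup_pinfty (fun t =>
       opow (tail_integral alpha r1 (sigma t)) (gamma / beta) *
       RInt (fun u => Rpower (r2 u) (- (1 / beta)) *
                      opow (RInt q t1 u) (1 / beta)) t1 t)))
  (hgab : gamma = alpha * beta) :
  property_A t0 alpha beta gamma r1 r2 q sigma.
Proof.
  assert (ha := odd_quotient_gt_0 alpha halpha).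
  assert (hb := odd_quotient_gt_0 beta hbeta).
  intros Ty y (hTy & (_ & dy & dL1 & dL2 & hyc & _ & _ & hD) & _).
  destruct (Classical_Prop.classic (oscillatory Ty y)) as [hosc | hnosc];
    [now left | right].
  assert (hnz : exists T0, forall t, T0 <= t -> Ty <= t -> y t <> 0).
  { apply Classical_Prop.NNPP. intros hno. apply hnosc. intros T0.
    apply Classical_Prop.NNPP. intros hno'. apply hno. exists T0.
    intros t h1 h2 h3. apply hno'. now exists t. }
  destruct hnz as [T0 hnz].
  (* Strictly to the right of [Ty] and [t0] every one-sided derivative is
     two-sided. *)
  set (T := Rmax T0 Ty + 1).
  assert (hT0 : T0 < T) by (assert (h := Rmax_l T0 Ty); unfold T; lra).
  assert (hT : Ty < T) by (assert (h := Rmax_r T0 Ty); unfold T; lra).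
  set (L1 := fun t => r1 t * opow (dy t) alpha).
  set (L2 := fun t => r2 t * opow (dL1 t) beta).
  set (w1 := fun s => Rpower (r1 s) (- (1 / alpha))).
  set (w2 := fun s => Rpower (r2 s) (- (1 / beta))).
  assert (dery : forall t, T <= t ->
    is_derive y t (w1 t * opow (L1 t) (1 / alpha))).
  { intros t ht. destruct (hD t) as (h & _); [lra |].
    unfold w1, L1. rewrite <- opow_solve by (assumption || (apply hr1p; lra)).
    apply D_in_half_line with Ty; [exact h | lra]. }
  assert (derL1 : forall t, T <= t ->
    is_derive L1 t (w2 t * opow (L2 t) (1 / beta))).
  { intros t ht. destruct (hD t) as (_ & h & _); [lra |].
    unfold w2, L2. rewrite <- opow_solve by (assumption || (apply hr2p; lra)).
    apply D_in_half_line with Ty; [exact h | lra]. }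
  assert (derL2 : forall t, T <= t ->
    is_derive L2 t (- (q t * opow (y (sigma t)) gamma))).
  { intros t ht. destruct (hD t) as (_ & _ & h & heq); [lra |].
    replace (- (q t * opow (y (sigma t)) gamma)) with (dL2 t) by lra.
    apply D_in_half_line with Ty; [exact h | lra]. }
  assert (hmon : forall s t, T <= s -> s <= t -> sigma s <= sigma t).
  { intros s t hs hst.
    apply increasing_of_derive_ge_0 with (df := dsigma); [exact hst | |].
    - intros x hx. apply D_in_half_line with t0; [apply hsd; lra | lra].
    - intros x hx. apply hsmon. lra. }
  assert (hfreq : forall a, T <= a -> forall M, exists t, M <= t /\
    1 < opow (tail1 w1 (sigma t)) alpha * iterated_integral beta w2 q a t).
  { intros a haT M.
    assert (hat0 : t0 <= a) by lra.
    destruct (LimSup_gt_frequently _ _ (hlimsup a hat0) M) as (t & ht & hgt).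
    replace (gamma / beta) with alpha in hgt by (rewrite hgab; field; lra).
    exists t. split; [exact ht | exact hgt]. }
  assert (hpositive : forall z M1 M2 : R -> R,
    (forall t, T <= t -> is_derive z t (w1 t * opow (M1 t) (1 / alpha))) ->
    (forall t, T <= t -> is_derive M1 t (w2 t * opow (M2 t) (1 / beta))) ->
    (forall t, T <= t ->
       is_derive M2 t (- (q t * opow (z (sigma t)) gamma))) ->
    (forall t, T <= t -> 0 < z t) -> is_lim z p_infty 0).
  { intros z M1 M2 hz hM1 hM2 hzpos.
    apply (positive_solution_tends_to_0 t0 T alpha beta gamma w1 w2 q sigma
             z M1 M2); try assumption.
    - lra.
    - intros t ht. now apply continuous_weight with t0.
    - intros t. apply exp_pos.
    - intros t ht. now apply continuous_weight with t0.
    - intros t. apply exp_pos.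
    - intros t ht. now apply continuous_half_line with t0.
    - intros t ht. apply hqp. lra.
    - intros t ht. apply hsadv. lra. }
  destruct (constant_sign_of_nonzero T y) as [hsign | hsign].
  - intros t ht. apply continuous_half_line with Ty; [exact hyc | lra].
  - intros t ht. apply hnz; lra.
  - now apply hpositive with L1 L2.
  - assert (h : is_lim (fun t => - y t) p_infty 0).
    { apply hpositive with (fun t => - L1 t) (fun t => - L2 t).
      - intros t ht. rewrite opow_opp, <- Ropp_mult_distr_r.
        apply (@is_derive_opp R_AbsRing R_NormedModule). now apply dery.
      - intros t ht. rewrite opow_opp, <- Ropp_mult_distr_r.
        apply (@is_derive_opp R_AbsRing R_NormedModule). now apply derL1.
      - intros t ht. rewrite opow_opp, <- Ropp_mult_distr_r.
        apply (@is_derive_opp R_AbsRing R_NormedModule). now apply derL2.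
      - intros t ht. specialize (hsign t ht). lra. }
    apply is_lim_opp in h. simpl in h. rewrite Ropp_0 in h.
    apply is_lim_ext with (2 := h). intros t. apply Ropp_involutive.
Qed.
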